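(* Let $q$ be a power of an odd prime, let $m\ge 2$ and $\varepsilon\in\{+1,-1\}$, and suppose that either $m>2$, or $m=2$ and $\varepsilon=+1$. Then the groups $G_1^\varepsilon$ and $G_2$ defined in the context are not isomorphic.
   Context: Quadratic form. $V=\mathbb{F}_q^{2m}$ (row vectors, standard basis $e_1,\dots,e_{2m}$) carries the quadratic form $Q(x)=x_1x_2+x_3x_4+\cdots+x_{2m-1}x_{2m}$ if $\varepsilon=+1$, and $Q(x)=x_1x_2+\cdots+x_{2m-3}x_{2m-2}+x_{2m-1}^2+bx_{2m}^2$ with $-b$ a nonsquare in $\mathbb{F}_q$ if $\varepsilon=-1$. Put $\beta(x,y)=Q(x+y)-Q(x)-Q(y)$. Affine group. Elements of $\mathrm{AGL}(2m,q)$ are written $[M,u]$ with $M\in\mathrm{GL}(2m,q)$, $u\in V$, acting by $x^{[M,u]}=xM+u$, with product $[M_1,v_1][M_2,v_2]=[M_1M_2,v_1M_2+v_2]$. $\mathrm{SO}^\varepsilon(2m,q)$ is the group of determinant-1 matrices preserving $Q$. For a subspace $U\le V$, $T_U=\{[I,u]:u\in U\}$. The group $G_1^\varepsilon$. Let $v\in V$ with $Q(v)\neq 0$, let $v^\perp=\{u\in V:\beta(u,v)=0\}$, and let $H$ be an elementary abelian subgroup of order $q$ of the stabilizer of $\langle v\rangle$ in $\mathrm{SO}^\varepsilon(2m,q)$ (such $H$ exists, and every element of $H$ fixes $v$). Fix an isomorphism $(\mathbb{F}_q,+)\to H$, $\alpha\mapsto A_\alpha$. Set $\mathcal{A}=\{[A_\alpha,\alpha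 v]:\alpha\in\mathbb{F}_q\}$, an elementary abelian group normalizing $T_{v^\perp}$, and $G_1^\varepsilon=\langle T_{v^\perp},\mathcal{A}\rangle=T_{v^\perp}:\mathcal{A}$. The group $G_2$. For $\alpha\in\mathbb{F}_q$ let $$B_\alpha=\begin{pmatrix}1&0&0&0\\0&1&-\alpha&0\\0&0&1&0\\\alpha&0&0&1\end{pmatrix},\qquad A'_\alpha=\begin{pmatrix}B_\alpha&0\\0&I_{2m-4}\end{pmatrix}$$ ($A'_\alpha=B_\alpha$ if $m=2$). Let $U=\langle e_1,e_4,e_5,\dots,e_{2m}\rangle$ (spanned by all $e_i$ except $e_2,e_3$), $\mathcal{B}=\langle [A'_\alpha,\alpha e_2+\gamma e_3]:\alpha,\gamma\in\mathbb{F}_q\rangle$, which normalizes $T_U$, and $G_2=\langle T_U,\mathcal{B}\rangle=T_U:\mathcal{B}$. *)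

(* Defs.v *)
From HB Require Import structures.
From mathcomp Require Import all_boot all_order all_algebra all_fingroup.
From mathcomp Require Import all_solvable all_field.

Set Implicit Arguments.
Unset Strict Implicit.
Unset Printing Implicit Defensive.

Import GRing.Theory.
Local Open Scope ring_scope.

(* {'GL_n[F]} consists of matrices of size n.-1.+1, so the row space F^(2m) is
   taken with dimension (2 * m).-1.+1, which is 2 * m as soon as m > 0. *)
Notation dimV m := ((2 * m)%N.-1.+1).
Notation "''V_' m [ F ]" := ('rV[F]_(dimV m))
  (at level 8, m at level 2, format "''V_' m [ F ]") : type_scope.

(* AGL(n, F): AGLpair M u is [M, u], the affine map x |-> x M + u, and affine
   maps compose from left to right. *)
Record agl (n : nat) (F : finFieldType) :=
  AGLpair { agl_lin : {'GL_n[F]}; agl_tr : 'rV[F]_n.-1.+1 }.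

Section AffineGroup.

Variables (n : nat) (F : finFieldType).
Implicit Types g : agl n F.

Definition agl_prod g := (agl_lin g, agl_tr g).
Definition agl_of_prod (z : {'GL_n[F]} * 'rV[F]_n.-1.+1) := AGLpair z.1 z.2.

Lemma agl_prodK : cancel agl_prod agl_of_prod. Proof. by case. Qed.

HB.instance Definition _ := Finite.copy (agl n F) (can_type agl_prodK).

Definition agl_one : agl n F := AGLpair 1%g 0.
Definition agl_mul g1 g2 : agl n F :=
  AGLpair (agl_lin g1 * agl_lin g2)%g (agl_tr g1 *m agl_lin g2 + agl_tr g2).
Definition agl_inv g : agl n F :=
  AGLpair (agl_lin g)^-1%g (- (agl_tr g *m GLval (agl_lin g)^-1%g)).

Lemma agl_mulA : associative agl_mul.
Proof.
case=> [M1 u1] [M2 u2] [M3 u3]; rewrite /agl_mul /=; congr AGLpair.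
  by rewrite mulgA.
by rewrite mulmxDl addrA -mulmxA.
Qed.

Lemma agl_mul1 : left_id agl_one agl_mul.
Proof. by case=> M u; rewrite /agl_mul /= mul1g mul0mx add0r. Qed.

Lemma agl_mulV : left_inverse agl_one agl_inv agl_mul.
Proof.
case=> M u; rewrite /agl_mul /agl_inv /agl_one /= mulVg; congr AGLpair.
by rewrite mulNmx -mulmxA mulVmx ?GL_unitmx // mulmx1 addNr.
Qed.

HB.instance Definition _ := Finite_isGroup.Build (agl n F)
  agl_mulA agl_mul1 agl_mulV.

Definition translations (S : {set 'rV[F]_n.-1.+1}) : {set agl n F} :=
  [set AGLpair 1%g u | u in S].

End AffineGroup.

(* Q has plus type, resp. minus type with last block y^2 + b z^2. *)
Variant qtype := Plus | Minus.

Section Groups.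

Variables (m : nat) (F : finFieldType).
Implicit Types (x y v : 'V_m[F]) (a c : F).

(* 1-based coordinates and standard basis vectors, for 1 <= k <= 2 * m. *)
Definition coord x (k : nat) : F := x 0 (inord k.-1).
Definition stdvec (k : nat) : 'V_m[F] := \row_j (j.+1 == k)%:R.

Definition Qform (eps : qtype) (b : F) x : F :=
  match eps with
  | Plus => \sum_(1 <= i < m.+1) coord x (2 * i).-1%N * coord x (2 * i)%N
  | Minus => (\sum_(1 <= i < m) coord x (2 * i).-1%N * coord x (2 * i)%N)
             + coord x (2 * m).-1%N ^+ 2 + b * coord x (2 * m)%N ^+ 2
  end.

Definition Qbeta eps b x y : F :=
  Qform eps b (x + y) - Qform eps b x - Qform eps b y.

Definition perpv eps b v : {set 'V_m[F]} := [set u | Qbeta eps b u v == 0].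

Definition SOgrp eps b : {set {'GL_(2 * m)[F]}} :=
  [set M : {'GL_(2 * m)[F]} |
    (\det M == 1) && [forall x, Qform eps b (x *m M) == Qform eps b x]].

Definition SOstab_line eps b v : {set {'GL_(2 * m)[F]}} :=
  [set M : {'GL_(2 * m)[F]} in SOgrp eps b | (v *m M == v)%MS].

Definition calA (A : F -> {'GL_(2 * m)[F]}) v : {set agl (2 * m) F} :=
  [set AGLpair (A a) (a *: v) | a : F].

Definition G1 eps b (A : F -> {'GL_(2 * m)[F]}) v : {group agl (2 * m) F} :=
  <<translations (perpv eps b v) :|: calA A v>>%G.

Definition Bmx a : 'M[F]_4 :=
  \matrix_(i, j) nth 0 (nth [::] [:: [:: 1; 0; 0; 0];
                                     [:: 0; 1; -a; 0];
                                     [:: 0; 0; 1; 0];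
                                     [:: a; 0; 0; 1]] i) j.

(* The block diagonal matrix diag(Bmx a, I), for m >= 2. *)
Definition Amx a : 'M[F]_(dimV m) :=
  \matrix_(i, j) (if (i < 4)%N && (j < 4)%N then Bmx a (inord i) (inord j)
                  else (i == j)%:R).

Lemma AmxE a (i j : 'I_(dimV m)) :
  Amx a i j = (i == j)%:R +
    a * (((i == 3 :> nat) && (j == 0 :> nat))%:R
         - ((i == 1 :> nat) && (j == 2 :> nat))%:R).
Proof.
rewrite mxE -(inj_eq val_inj) /=; case: ifP => [/andP[]|].
  move=> lti ltj; rewrite mxE !inordK //.
  by move: (i : nat) (j : nat) lti ltj => [|[|[|[|?]]]] [|[|[|[|?]]]] //= _ _;
    rewrite ?subrr ?subr0 ?sub0r ?mulr0 ?mulr1 ?mulrN1 ?addr0 ?add0r.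
move: (i : nat) (j : nat) => [|[|[|[|?]]]] [|[|[|[|?]]]] //= _;
  by rewrite ?andbF subrr mulr0 addr0.
Qed.

Lemma AmxM a c : Amx a *m Amx c = Amx (a + c).
Proof.
pose N : 'M[F]_(dimV m) := \matrix_(i, j)
  (((i == 3 :> nat) && (j == 0 :> nat))%:R
   - ((i == 1 :> nat) && (j == 2 :> nat))%:R).
have AN d : Amx d = 1%:M + d *: N by apply/matrixP=> i j; rewrite AmxE !mxE.
have NN : N *m N = 0.
  apply/matrixP=> i j; rewrite !mxE big1 // => k _; rewrite !mxE.
  by move: (k : nat) => [|[|[|[|?]]]] /=;
    rewrite ?andbF /= ?subrr ?mulr0 ?mul0r.
rewrite !AN mulmxDl !mulmxDr !mul1mx mulmx1 -scalemxAl -scalemxAr NN !scaler0.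
by rewrite addr0 scalerDl -addrA; congr (_ + _); rewrite addrC.
Qed.

Lemma Amx_unit a : Amx a \is a GRing.unit.
Proof.
have A0 : Amx 0 = 1%:M.
  by apply/matrixP=> i j; rewrite AmxE mul0r addr0 mxE.
by apply: (proj1 (@mulmx1_unit _ _ (Amx a) (Amx (- a)) _)); rewrite AmxM subrr.
Qed.

Definition Agl a : {'GL_(2 * m)[F]} := FinRing.unit _ (Amx_unit a).

Definition Uset : {set 'V_m[F]} :=
  [set u in <<[seq stdvec k | k <- iota 1 (2 * m) & k \notin [:: 2; 3]%N]>>%VS].

Definition calB : {group agl (2 * m) F} :=
  <<[set AGLpair (Agl a) (a *: stdvec 2 + c *: stdvec 3) | a : F, c : F]>>%G.

Definition G2 : {group agl (2 * m) F} := <<translations Uset :|: calB>>%G.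

End Groups.

(* Main.v *)
Require Import Defs.
From HB Require Import structures.
From mathcomp Require Import all_boot all_order all_algebra all_fingroup.
From mathcomp Require Import all_solvable all_field.
From mathcomp Require Import zify ring.

Set Implicit Arguments.
Unset Strict Implicit.
Unset Printing Implicit Defensive.

Import GRing.Theory.
Local Open Scope ring_scope.

(** The two groups have derived subgroups of different orders.

    Writing [A'_a] as [1 + a N], the map [N] sends [u] to [u_4 e_1 - u_2 e_3],
    and every element of [G_2] has the form [[A'_a, u]] with [u_2 = a].  Two
    such elements commute up to a translation along [e_1]: the [e_3]
    components of the two products agree.  Hence the derived subgroup of
    [G_2] has at most [q] elements ([card_G2_der]).

    The derived subgroup of [G_1] contains the translations by [w M - w] for
    [w] in [v^perp] and [M = A_1] ([card_G1_der]).  Since [M] is an isometry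
    of odd order, it fixes [v] itself and not only its line
    ([odd_isometry_eigen1]); as [Q v != 0], the space is the direct sum of
    [v^perp] and the line of [v], so these vectors fill the whole image of
    [M - 1].  If the groups were isomorphic, this image would have at most
    [q] elements, so [M - 1] would have rank at most one.  An isometry of a
    nondegenerate quadratic form in odd characteristic for which [M - 1] has
    rank one is a reflection, which has order 2, whereas [M] has odd order;
    so [M = 1] ([odd_isometry_rank1]), contradicting the injectivity of
    [a |-> A_a]. *)

(* Entries of a row vector, not coordinates in a tuple of vectors. *)
Local Notation coord := Defs.coord.

(** * Isometries of odd order *)

Section Polar.

Variables (F : fieldType) (V : lmodType F) (Q : V -> F).

Definition polar x y := Q (x + y) - Q x - Q y.

Hypothesis two_neq0 : 2%:R != 0 :> F.
Hypothesis QZ : forall a x, Q (a *: x) = a ^+ 2 * Q x.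
Hypothesis polarDl : forall x y z, polar (x + y) z = polar x z + polar y z.
Hypothesis polarZl : forall a x z, polar (a *: x) z = a * polar x z.

Lemma polarxx x : polar x x = 2%:R * Q x.
Proof. by rewrite /polar -mulr2n -scaler_nat QZ; ring. Qed.

Lemma perp_decomp v x : Q v != 0 -> exists d, polar (x - d *: v) v = 0.
Proof.
move=> Qv; exists (polar x v / polar v v).
by rewrite -scaleNr polarDl polarZl mulNr divfK ?subrr // polarxx mulf_neq0.
Qed.

Variables (g : {linear V -> V}) (N : nat).
Hypothesis g_isom : forall x, Q (g x) = Q x.
Hypothesis g_per : forall x, iter N g x = x.
Hypothesis N_odd : odd N.

(** Comparing [Q (g v)] with [Q v] shows that the eigenvalue is [1] or [-1],
    and [-1] has no odd power equal to [1]. *)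
Lemma odd_isometry_eigen1 v c : Q v != 0 -> g v = c *: v -> g v = v.
Proof.
move=> Qv gv.
have c2 : c ^+ 2 = 1 by apply: (mulIf Qv); rewrite -QZ -gv g_isom mul1r.
have giter n : iter n g v = c ^+ n *: v.
  elim: n => [|n IHn]; first by rewrite scale1r.
  by rewrite iterS IHn linearZ /= gv scalerA -exprSr.
have cN : c ^+ N = c.
  by rewrite -[N]odd_double_half N_odd exprS -mul2n exprM c2 expr1n mulr1.
by rewrite gv -cN -giter g_per.
Qed.

(** Were [u = g x0 - x0] nonzero, expanding [Q (x + c u) = Q x] would give
    [g x = x - (polar x u / Q u) u], the reflection in [u]; it negates [u],
    and so do all its odd powers. *)
Lemma odd_isometry_rank1 x0 :
  (forall u, (forall x, polar x u = 0) -> u = 0) ->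
  (forall x, exists c, g x - x = c *: (g x0 - x0)) -> g x0 = x0.
Proof.
move=> nondeg rk1; apply/eqP; rewrite -subr_eq0; apply/eqP.
set u := g x0 - x0 in rk1 *.
have QD x y : Q (x + y) = Q x + Q y + polar x y by rewrite /polar; ring.
have isoc x c : g x - x = c *: u -> c != 0 -> polar x u = - (c * Q u).
  move=> gx c0; apply/(mulfI c0)/eqP; rewrite -subr_eq0; apply/eqP.
  have := g_isom x; rewrite -[g x](subrK x) gx QD QZ polarZl.
  rewrite (_ : polar u x = polar x u); last first.
    by rewrite /polar [u + x]addrC addrAC.
  by move=> E; rewrite -[RHS](subrr (Q x)) -{1}E; ring.
(* Expanding [Q] says nothing when [g x = x]; adding [x0], which [g] moves by
   exactly [u], reduces this case to the other one. *)
have pu x : exists2 c, g x - x = c *: u & polar x u = - (c * Q u).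
  have [c gx] := rk1 x; exists c => //.
  have [c0|] := eqVneq c 0; last exact: isoc gx.
  have p0 : polar x0 u = - (1 * Q u).
    by apply: isoc; rewrite ?oner_neq0 // scale1r.
  have : polar (x0 + x) u = - (1 * Q u).
    apply: isoc; rewrite ?oner_neq0 // linearD /= opprD addrACA gx c0 scale0r.
    by rewrite addr0 scale1r.
  rewrite polarDl p0 => /eqP; rewrite -subr_eq0 addrC addKr => /eqP->.
  by rewrite c0 mul0r oppr0.
(* A singular [u] would be orthogonal to every vector. *)
have [Qu|Qu] := eqVneq (Q u) 0.
  by apply: nondeg => x; have [c _ ->] := pu x; rewrite Qu mulr0 oppr0.
(* At [x = u] the relation reads [2 Q u = - (c Q u)], so [c = -2]. *)
have [c gu /esym/eqP] := pu u; rewrite polarxx -mulNr => /eqP/(mulIf Qu) c2.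
have {}gu : g u = - u.
  rewrite -[g u](subrK u) gu -[c]opprK c2; rewrite scaleNr scaler_nat mulr2n.
  by rewrite opprD subrK.
have giter n : iter n g u = (-1) ^+ n *: u.
  elim: n => [|n IHn]; first by rewrite scale1r.
  by rewrite iterS IHn linearZ /= gu exprSr -scalerA scaleN1r.
have := g_per u; rewrite giter -signr_odd N_odd expr1 scaleN1r => /eqP.
rewrite -subr_eq0 -opprD oppr_eq0 -mulr2n -scaler_nat scaler_eq0.
by rewrite (negPf two_neq0) /= => /eqP.
Qed.

End Polar.

(** * Nondegeneracy of the quadratic form *)

Section Form.

Variables (m : nat) (F : finFieldType).
Implicit Types (x y z u v : 'V_m[F]) (a c : F).

Lemma coordD x y k : coord (x + y) k = coord x k + coord y k.
Proof. by rewrite /coord mxE. Qed.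

Lemma coordZ a x k : coord (a *: x) k = a * coord x k.
Proof. by rewrite /coord mxE. Qed.

Lemma coord_stdvec j k : (0 < j <= 2 * m)%N ->
  coord (stdvec m F k) j = (j == k)%:R.
Proof. by case: j => // j lejm; rewrite /coord mxE inordK //; lia. Qed.

Lemma coord_eq0 y : (forall k, (0 < k <= 2 * m)%N -> coord y k = 0) ->
  (0 < m)%N -> y = 0.
Proof.
move=> y0 m0; apply/rowP=> j; rewrite mxE.
have := y0 j.+1; rewrite /coord /= inord_val; apply.
by have := ltn_ord j; lia.
Qed.

(** The polar form of either quadratic form is [hyp n x y + hyp n y x], plus
    an explicit diagonal term on the last plane in the minus case, so that its
    bilinearity and nondegeneracy follow from properties of [hyp]. *)
Definition hyp n x y :=
  \sum_(1 <= i < n) coord x (2 * i).-1 * coord y (2 * i)%N.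

Lemma hypDl n x y z : hyp n (x + y) z = hyp n x z + hyp n y z.
Proof.
by rewrite /hyp -big_split; apply: eq_bigr => i _; rewrite coordD mulrDl.
Qed.

Lemma hypDr n x y z : hyp n z (x + y) = hyp n z x + hyp n z y.
Proof.
by rewrite /hyp -big_split; apply: eq_bigr => i _; rewrite coordD mulrDr.
Qed.

Lemma hypZl n a x z : hyp n (a *: x) z = a * hyp n x z.
Proof.
by rewrite /hyp mulr_sumr; apply: eq_bigr => i _; rewrite coordZ mulrA.
Qed.

Lemma hypZr n a x z : hyp n z (a *: x) = a * hyp n z x.
Proof.
by rewrite /hyp mulr_sumr; apply: eq_bigr => i _; rewrite coordZ mulrCA.
Qed.

Lemma hyp_stdvecl n k y : (n <= m.+1)%N ->
  hyp n (stdvec m F k) y =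
    \sum_(1 <= i < n | (2 * i).-1 == k) coord y (2 * i)%N.
Proof.
move=> lenm; rewrite /hyp big_nat [RHS]big_nat_cond [RHS]big_mkcondr /=.
apply: eq_bigr => i ltin; rewrite coord_stdvec; last by lia.
by case: ifP => _; rewrite ?mul1r ?mul0r.
Qed.

Lemma hyp_stdvecr n k y : (n <= m.+1)%N ->
  hyp n y (stdvec m F k) =
    \sum_(1 <= i < n | (2 * i)%N == k) coord y (2 * i).-1.
Proof.
move=> lenm; rewrite /hyp big_nat [RHS]big_nat_cond [RHS]big_mkcondr /=.
apply: eq_bigr => i ltin; rewrite coord_stdvec; last by lia.
by case: ifP => _; rewrite ?mulr1 ?mulr0.
Qed.

Lemma Qform_Plus b x : Qform Plus b x = hyp m.+1 x x.
Proof. by []. Qed.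

Lemma Qform_Minus b x : Qform Minus b x =
  hyp m x x + coord x (2 * m).-1 ^+ 2 + b * coord x (2 * m)%N ^+ 2.
Proof. by []. Qed.

Definition QformE := (Qform_Plus, Qform_Minus).

Lemma QformZ eps b a x : Qform eps b (a *: x) = a ^+ 2 * Qform eps b x.
Proof. by case: eps; rewrite !QformE !hypZl !hypZr ?coordZ; ring. Qed.

Lemma Qbeta_Plus b x y : Qbeta Plus b x y = hyp m.+1 x y + hyp m.+1 y x.
Proof. by rewrite /Qbeta !QformE !hypDl !hypDr; ring. Qed.

Lemma Qbeta_Minus b x y : Qbeta Minus b x y =
  hyp m x y + hyp m y x + 2%:R * (coord x (2 * m).-1 * coord y (2 * m).-1)
  + 2%:R * b * (coord x (2 * m)%N * coord y (2 * m)%N).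
Proof. by rewrite /Qbeta !QformE !hypDl !hypDr !coordD; ring. Qed.

Definition QbetaE := (Qbeta_Plus, Qbeta_Minus).

Lemma QbetaDl eps b x y z :
  Qbeta eps b (x + y) z = Qbeta eps b x z + Qbeta eps b y z.
Proof. by case: eps; rewrite !QbetaE !hypDl !hypDr ?coordD; ring. Qed.

Lemma QbetaZl eps b a x z : Qbeta eps b (a *: x) z = a * Qbeta eps b x z.
Proof. by case: eps; rewrite !QbetaE !hypZl !hypZr ?coordZ; ring. Qed.

(** Each basis vector of a hyperbolic plane pairs with the other one, so
    testing [y] against one of them reads off the other coordinate. *)
Lemma hyp_nondeg n y : (n <= m.+1)%N ->
  (forall k, (0 < k < (2 * n).-1)%N ->
    hyp n (stdvec m F k) y + hyp n y (stdvec m F k) = 0) ->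
  forall k, (0 < k < (2 * n).-1)%N -> coord y k = 0.
Proof.
move=> lenm y0 k kn.
have {kn} [i lin kE] : exists2 i, (1 <= i < n)%N &
    k = (2 * i)%N \/ k = (2 * i).-1 by exists (k.+1./2); lia.
have pick (f : nat -> F) (P : pred nat) :
    (forall j, (1 <= j < n)%N -> P j = (j == i)) ->
    \sum_(1 <= j < n | P j) f j = f i.
  move=> Pi; rewrite big_nat_cond.
  rewrite (eq_bigl (fun j => (1 <= j < n)%N && (j == i))).
    by rewrite -big_nat_cond big_nat1_eq lin.
  by move=> j; case: (boolP (1 <= j < n)%N) => // /Pi.
have none (f : nat -> F) (P : pred nat) :
    (forall j, (1 <= j < n)%N -> ~~ P j) -> \sum_(1 <= j < n | P j) f j = 0.
  move=> P0; rewrite big_nat_cond big1 // => j /andP[/P0/negPf->] //.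
case: kE => ->.
  have := y0 (2 * i).-1; rewrite hyp_stdvecl // hyp_stdvecr //.
  by rewrite pick ?none ?addr0; try (move=> ? ?; lia); apply; lia.
have := y0 (2 * i)%N; rewrite hyp_stdvecl // hyp_stdvecr //.
by rewrite none ?pick ?add0r; try (move=> ? ?; lia); apply; lia.
Qed.

Lemma Qbeta_nondeg eps b u : (0 < m)%N -> 2%:R != 0 :> F ->
  (eps = Minus -> b != 0) -> (forall x, Qbeta eps b x u = 0) -> u = 0.
Proof.
move=> m0 two0 b0 u0; apply: coord_eq0 => // k km.
case: eps b0 u0 => b0 u0.
  apply: (@hyp_nondeg m.+1) => // [j jm|]; last by lia.
  by rewrite -(Qbeta_Plus b) u0.
have small : (0 < k < (2 * m).-1)%N -> coord u k = 0.
  apply: (@hyp_nondeg m) => // j jm.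
  rewrite -[RHS](u0 (stdvec m F j)) Qbeta_Minus.
  rewrite !coord_stdvec; try lia.
  have [-> ->] : ((2 * m).-1 == j) = false /\ ((2 * m)%N == j) = false by lia.
  by rewrite !mul0r !mulr0 !addr0.
have last2 j : ((2 * m).-1 <= j)%N -> Qbeta Minus b (stdvec m F j) u =
    2%:R * (((2 * m).-1 == j)%:R * coord u (2 * m).-1)
    + 2%:R * b * (((2 * m)%N == j)%:R * coord u (2 * m)%N).
  move=> jm; rewrite Qbeta_Minus hyp_stdvecl // hyp_stdvecr //.
  rewrite !coord_stdvec; try lia.
  rewrite big_nat_cond big1 => [|i]; last by lia.
  by rewrite big_nat_cond big1 ?addr0 ?add0r // => i; lia.
have [/small//|] := boolP (0 < k < (2 * m).-1)%N => kge.
have [kE|kE] : k = (2 * m).-1 \/ k = (2 * m)%N by lia.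
  have /eqP := u0 (stdvec m F (2 * m).-1); rewrite last2 // eqxx.
  have -> : ((2 * m)%N == (2 * m).-1) = false by lia.
  by rewrite mul0r mulr0 addr0 mul1r mulf_eq0 (negPf two0) kE => /eqP.
have /eqP := u0 (stdvec m F (2 * m)%N); rewrite last2 ?eqxx; last by lia.
have -> : ((2 * m).-1 == (2 * m)%N) = false by lia.
rewrite mul0r mulr0 add0r mul1r !mulf_eq0 (negPf two0) (negPf (b0 _)) //= kE.
by move=> /eqP.
Qed.

End Form.

(** * The derived subgroup of the second group *)

Section G2der.

Variables (m : nat) (F : finFieldType).
Hypothesis m_ge2 : (2 <= m)%N.
Implicit Types (x y z u v : 'V_m[F]) (a c : F).

Lemma mul_Amx u a :
  u *m Amx m a =
    u + a *: (coord u 4 *: stdvec m F 1 - coord u 2 *: stdvec m F 3).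
Proof.
apply/rowP=> j; rewrite !mxE /coord.
transitivity (\sum_i (u 0 i * (i == j)%:R
   + a * (u 0 i * (i == inord 3)%:R * (j.+1 == 1%N)%:R
   - u 0 i * (i == inord 1)%:R * (j.+1 == 3)%:R))).
  apply: eq_bigr => i _; rewrite AmxE -!(inj_eq val_inj) /= !inordK; try lia.
  by rewrite !eqSS -!mulnb !natrM; ring.
have sumd k : \sum_i u 0 i * (i == k)%:R = u 0 k.
  rewrite (bigD1 k) //= eqxx mulr1 big1 ?addr0 // => i /negPf->.
  by rewrite mulr0.
by rewrite big_split /= sumd -mulr_sumr sumrB -!mulr_suml !sumd.
Qed.

Lemma agl_mulE (n : nat) (M N : {'GL_n[F]}) (u w : 'rV[F]_n.-1.+1) :
  (AGLpair M u * AGLpair N w)%g = AGLpair (M * N)%g (u *m val N + w).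
Proof. by []. Qed.

Lemma AglD a c : (Agl m a * Agl m c)%g = Agl m (a + c).
Proof. by apply: val_inj; rewrite /= -AmxM. Qed.

Lemma Agl0 : Agl m (0 : F) = 1%g.
Proof.
by apply: val_inj; apply/matrixP=> i j; rewrite AmxE mul0r addr0 mxE.
Qed.

(** A group containing the generators of [G2], with membership given by one
    equation: commutators in [G2] are computed from it, with no need for a
    normal form of products of generators. *)
Definition shears : {set agl (2 * m) F} :=
  [set g | agl_lin g == Agl m (coord (agl_tr g) 2)].

Lemma shears_group_set : group_set shears.
Proof.
apply/group_setP; split=> [|[M u] [N w]]; rewrite !inE /=.
  by rewrite /coord mxE Agl0.
move=> /eqP-> /eqP->; rewrite AglD mul_Amx !coordD coordZ -scaleN1r coordD.
rewrite !coordZ !coord_stdvec; try lia.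
by rewrite !mulr0 !addr0 mulr0 addr0.
Qed.
Canonical shears_group := Group shears_group_set.

Lemma coord_span0 (X : seq 'V_m[F]) k u :
  {in X, forall x, coord x k = 0} -> u \in <<X>>%VS -> coord u k = 0.
Proof.
elim: X u => [|x X IHX] u X0; first by
  rewrite span_nil memv0 => /eqP->; rewrite /coord mxE.
rewrite span_cons => /memv_addP[_ /vlineP[c ->] [w wX ->]].
rewrite coordD coordZ X0 ?mem_head // mulr0 add0r IHX // => y yX.
by rewrite X0 // inE yX orbT.
Qed.

Lemma G2_sub_shears : G2 m F \subset shears.
Proof.
rewrite gen_subG subUset gen_subG; apply/andP; split; apply/subsetP=> g.
  case/imsetP=> u; rewrite inE => uU ->; rewrite inE /=.
  rewrite (coord_span0 _ uU) ?Agl0 // => _ /mapP[k + ->].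
  rewrite mem_filter !inE => kX; rewrite coord_stdvec; last by lia.
  by have -> : (2%N == k) = false by lia.
case/imset2P=> a c _ _ ->; rewrite inE /= coordD !coordZ.
by rewrite !coord_stdvec ?mulr1 ?mulr0 ?addr0 //; lia.
Qed.

Definition axis_translations := translations [set a *: stdvec m F 1 | a : F].

Lemma axis_translations_group_set : group_set axis_translations.
Proof.
apply/group_setP; split=> [|_ h /imsetP[_ /imsetP[a _ ->] ->]].
  apply/imsetP; exists 0 => //.
  by apply/imsetP; exists 0; rewrite ?scale0r.
case/imsetP=> _ /imsetP[c _ ->] ->{h}; rewrite agl_mulE mulg1 mulmx1 -scalerDl.
by do 2![apply: imset_f].
Qed.
Canonical axis_group := Group axis_translations_group_set.

(** With [a = u_2] and [c = w_2], the linear parts contribute [- a c e_3] to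
    the translation part of either product, so only the [e_1] components,
    [c u_4] and [a w_4], differ. *)
Lemma shears_comm g h :
  g \in shears -> h \in shears -> [~ g, h]%g \in axis_translations.
Proof.
case: g h => [M u] [N w]; rewrite !inE /= => /eqP-> /eqP->.
set a := coord u 2; set c := coord w 2.
apply/imsetP; exists ((c * coord u 4 - a * coord w 4) *: stdvec m F 1).
  exact: imset_f.
apply: (mulgI (AGLpair (Agl m c) w * AGLpair (Agl m a) u)%g).
rewrite -commgC !agl_mulE mulmx1 mulg1 !AglD addrC !mul_Amx -/a -/c.
congr AGLpair; apply/rowP=> j; rewrite !mxE; ring.
Qed.

Lemma card_G2_der : (#|(G2 m F)^`(1)%g| <= #|F|)%N.
Proof.
apply: (@leq_trans #|axis_translations|); last first.
  by rewrite !(leq_trans (leq_imset_card _ _)).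
apply: subset_leq_card; rewrite gen_subG.
apply/subsetP=> _ /imset2P[g h gG hG ->].
by apply: shears_comm; apply: (subsetP G2_sub_shears).
Qed.

End G2der.

(** * The derived subgroup of the first group *)

(** The commutator of the translation by [w] with [[A a, a v]] is the
    translation by [w A_a - w]. *)
Lemma card_G1_der m (F : finFieldType) eps b (A : F -> {'GL_(2 * m)[F]}) v a :
  (#|[set (w *m val (A a) - w)%R | w in perpv eps b v]|
     <= #|(G1 eps b A v)^`(1)%g|)%N.
Proof.
have injT : injective (AGLpair (1%g : {'GL_(2 * m)[F]})) by move=> x y [].
rewrite -(card_imset _ injT).
apply/subset_leq_card/subsetP=> _ /imsetP[_ /imsetP[w wv ->] ->].
set t := AGLpair _ _.
suffices -> : t = [~ AGLpair 1%g w, AGLpair (A a) (a *: v)]%g.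
  apply: mem_commg; apply: mem_gen; rewrite inE; first by rewrite imset_f.
  by apply/orP; right; apply: imset_f.
apply: (mulgI (AGLpair (A a) (a *: v) * AGLpair 1%g w)%g).
rewrite -commgC !agl_mulE !mulg1 mul1g !mulmx1; congr AGLpair.
by rewrite [LHS]addrACA subrr addr0 addrC.
Qed.

(** * The two groups are not isomorphic *)

Theorem theorem3p9 (q p k : nat) (F : finFieldType) (m : nat) (eps : qtype)
    (b : F) (v : 'V_m[F]) (H : {group {'GL_(2 * m)[F]}})
    (A : {morphism [set: F] >-> {'GL_(2 * m)[F]}}) :
  prime p -> odd p -> q = (p ^ k)%N -> #|F| = q ->
  (2 <= m)%N ->
  (2 < m)%N \/ (m = 2%N /\ eps = Plus) ->
  (eps = Minus -> ~ (exists c : F, c ^+ 2 = - b)) ->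
  Qform eps b v != 0 ->
  H \subset SOstab_line eps b v -> (p.-abelem H)%g -> #|H| = q ->
  isom [set: F] H A ->
  ~ (G1 eps b A v \isog G2 m F)%g.
Proof.
move=> _ p_odd qE cardF m2 _ nsq Qv HSO _ _ isoA isoG.
have q_odd : odd #|F| by rewrite cardF qE oddX p_odd orbT.
have natF : (#|F|%:R = 0 :> F).
  by rewrite -FinRing.zmodXgE -cardsT expg_cardG ?inE.
have two0 : 2%:R != 0 :> F.
  apply/eqP=> two0; have /eqP := natF; rewrite -[#|F|]odd_double_half q_odd.
  by rewrite -muln2 natrD natrM two0 mulr0 addr0 oner_eq0.
have b0 : eps = Minus -> b != 0.
  move=> /nsq sq; apply/eqP=> b0; apply: sq.
  by exists 0; rewrite b0 oppr0 expr0n.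
pose M := val (A 1).
have AH : A 1 \in H.
  by case/isomP: isoA => _ <-; rewrite mem_morphim ?inE.
have {AH HSO} := subsetP HSO _ AH.
rewrite !inE => /andP[/andP[_ /forallP QM] vM].
have isoM x : Qform eps b (mulmxr M x) = Qform eps b x by apply/eqP/QM.
have {vM} [c vM] : exists c, v *m M = c *: v.
  by case/andP: vM => /sub_rVP.
(* [M] has odd order because its [q]-th power is [A (q * 1) = A 0]. *)
have perM (x : 'V_m[F]) : iter #|F| (mulmxr M) x = x.
  have itM n : iter n (mulmxr M) x = x *m val (A n%:R).
    elim: n => [|n IHn]; first by rewrite (morph1 A) mulmx1.
    rewrite iterS IHn /= -mulmxA -natr1.
    by rewrite (morphM A (in_setT n%:R) (in_setT 1)).
  by rewrite itM natF (morph1 A) mulmx1.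
have [x xM] : exists x : 'V_m[F], x *m M != x.
  apply/existsP; apply: contraT; rewrite negb_exists => /forallP Mid.
  have A1 : A 1 = 1%g.
    apply: val_inj; apply/row_matrixP=> i; rewrite !rowE /= mulmx1.
    by apply/eqP; rewrite -[_ == _]negbK.
  have injA : {in [set: F] &, injective A} by apply/injmP/(isom_inj isoA).
  have /eqP : (1 : F) = 0 by apply: injA; rewrite ?inE // A1 [A 0]morph1.
  by rewrite oner_eq0.
(* The component of [y] along [v] is fixed, hence invisible to [M - 1]. *)
have decomp y : exists2 w, w \in perpv eps b v & w *m M - w = y *m M - y.
  have [d dv] := perp_decomp two0 (QformZ eps b) (QbetaDl eps b)
    (QbetaZl eps b) y Qv.
  exists (y - d *: v); first by rewrite inE /Qbeta -/(polar _ _ _) dv.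
  have vfix := odd_isometry_eigen1 (QformZ eps b) isoM perM q_odd Qv vM.
  rewrite mulmxBl -scalemxAl -[v *m M]/(mulmxr M v) vfix opprB.
  by rewrite addrA subrK.
pose S := [set (w *m val (A 1) - w)%R | w in perpv eps b v].
have cardS : (#|S| <= #|F|)%N.
  apply: leq_trans (card_G1_der _ _ _ _ _) _.
  by rewrite (card_isog (isog_der 1 isoG)) card_G2_der.
have fix_x := odd_isometry_rank1 two0 (QformZ eps b) (QbetaDl eps b)
  (QbetaZl eps b) isoM perM q_odd.
case/eqP: (xM); apply: fix_x.
  by move=> u; exact: (Qbeta_nondeg (ltnW m2) two0 b0).
have inS y : y *m M - y \in S.
  by have [w wv <-] := decomp y; apply: imset_f.
set u := x *m M - x.
(* The image of [M - 1] is closed under scaling, so it contains the [q]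
   multiples of [u]; having at most [q] elements, it consists of them. *)
have lineS : [set c *: u | c : F] = S.
  have injL : injective (fun c : F => c *: u).
    move=> c1 c2 /eqP; rewrite -subr_eq0 -scalerBl scaler_eq0 !subr_eq0.
    by rewrite (negPf xM) orbF => /eqP.
  apply/eqP; rewrite eqEcard (card_imset _ injL).
  rewrite cardS andbT; apply/subsetP=> _ /imsetP[d _ ->].
  by rewrite scalerBr scalemxAl inS.
by move=> y; have := inS y; rewrite -lineS => /imsetP[d _ dE]; exists d.
Qed.
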